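(* Let $G=(V,E)$ be an $n$-node weighted graph with weights in $[1,n^{C}]$ for a constant $C>0$. With high probability, the linear routing $R$ produced by the LDD-based procedure described in the context is an $\exp\big(O(\log n\cdot\log\log n)^{3/4}\big)$-approximate $\ell_1$-oblivious routing.
   Context: Notation: $B$ is the incidence matrix of a fixed orientation $\vec E$, $W$ the diagonal weight matrix; $d$ proper means $\sum_v d_v=0$; $\|d\|_{\mathrm{OPT}}=\min\{\|Wf\|_1:Bf=d\}$; $R\in\mathbb{R}^{\vec E\times V}$ is an $\alpha$-approximate $\ell_1$-oblivious routing if $BRd=d$ and $\|WRd\|_1\le\alpha\|d\|_{\mathrm{OPT}}$ for all proper $d$. ''With high probability'' means with probability at least $1-n^{-C'}$ for an arbitrarily large constant $C'$. A low-diameter decomposition (LDD) of radius $\rho$ and quality $\alpha\ge1$ is a probability distribution over partitions of $V$ into connected components $S_1,\dots,S_k$ with centers $c_j\in S_j$ such that (1) w.h.p. $c_j$ is within distance $\rho$ of every node of $S_j$ in the induced subgraph $G[S_j]$, and (2) any $x,y\in V$ at distance $\delta$ in $G$ lie in different components with probability at most $\alpha\delta/\rho$. Assume such LDDs can be sampled for every radius. Procedure: let $\alpha:=\exp(O(\sqrt{\log n\log\log n}))$, $\rho:=\exp(O(\log n\log\log n)^{3/4})$, $i_{\max}:=O((\log n)^{1/4})$ chosen with $\rho^{i_{\max}}\ge n^{C+1}$, and $g:=O(\log n)\cdot\rho/\alpha$ (with a sufficiently large constant). Given a demand $d_0$, for $i=1,\dots,i_{\max}$: sample $g$ independent LDDs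 $\mathcal P^i_1,\dots,\mathcal P^i_g$ of radius $\rho^i$ and quality $\alpha$; each node $v$ sends $\frac1g d_{i-1}(v)$ to the center of its component in each $\mathcal P^i_j$ along a path of length at most $\rho^i$ (the path in the shortest path tree of the component rooted at the center); the resulting amounts accumulated at nodes form the next demand $d_i$. Finally, take an arbitrary spanning tree $T$ with root $r$ and send each $d_{i_{\max}}(v)$ to $r$ along $T$. The total flow sent is linear in $d_0$; $R$ denotes this linear map $d_0\mapsto$ flow. *)

(* Defs.v *)
From HB Require Import structures.
From mathcomp Require Import all_boot all_order all_algebra.
From mathcomp Require Import all_classical all_reals all_analysis.

Set Implicit Arguments.
Unset Strict Implicit.
Unset Printing Implicit Defensive.

Import Order.TTheory GRing.Theory Num.Theory.
Import numFieldNormedType.Exports.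

Local Open Scope classical_set_scope.
Local Open Scope ring_scope.

(* f = exp(O(h)) as n tends to infinity. *)
Definition is_expO (R : realType) (f h : nat -> R) : Prop :=
  exists2 u : nat -> R, u =O_\oo h & forall n, f n = expR (u n).

(* Probability distributions on a finite type. *)
Record fdist (R : realType) (T : finType) := FDist {
  pmf :> T -> R;
  pmf_ge0 : forall x, 0 <= pmf x;
  pmf_sum1 : \sum_x pmf x = 1 }.

Definition Pr (R : realType) (T : finType) (mu : fdist R T) (A : set T) : R :=
  \sum_(x | x \in A) mu x.

Section IndependentSamples.
Variables (R : realType) (I T : finType) (mu : I -> fdist R T).

Definition indep_pmf (w : {ffun I -> T}) : R := \prod_i mu i (w i).

Lemma indep_pmf_ge0 w : 0 <= indep_pmf w.
Proof. by apply: prodr_ge0 => i _; exact: pmf_ge0. Qed.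

Lemma indep_pmf_sum1 : \sum_w indep_pmf w = 1.
Proof.
rewrite /indep_pmf -(bigA_distr_bigA (fun i => mu i)).
by apply: big1 => i _; exact: pmf_sum1.
Qed.

(* Joint law of independent samples, the i-th one distributed as [mu i]. *)
Definition indep_samples : fdist R {ffun I -> T} :=
  FDist indep_pmf_ge0 indep_pmf_sum1.

End IndependentSamples.

(* A simple undirected weighted graph on the nodes 'I_n; its m edges are listed
   with a fixed orientation, edge e going from [etail e] to [ehead e]. *)
Record wgraph (R : realType) (n m : nat) := WGraph {
  etail : 'I_m -> 'I_n;
  ehead : 'I_m -> 'I_n;
  weight : 'I_m -> R;
  wgraph_loopless : forall e, etail e != ehead e;
  wgraph_simple : forall e f,
    [set etail e; ehead e]%SET = [set etail f; ehead f]%SET -> e = f }.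

Definition l1norm (R : realType) (k : nat) (x : 'cV[R]_k) : R :=
  \sum_i `|x i 0|.

Definition proper_demand (R : realType) (n : nat) (d : 'cV[R]_n) : Prop :=
  \sum_v d v 0 = 0.

Section Graph.
Variables (R : realType) (n m : nat) (G : wgraph R n m).

Implicit Types (F : {set 'I_m}) (S : {set 'I_n}) (x y v c r : 'I_n).

(* Sign convention: (B f) v is the net flow out of v, so that f routes the
   demand d (node v sends d v) when B f = d. *)
Definition incidence_mx : 'M[R]_(n, m) :=
  \matrix_(v, e) ((v == etail G e)%:R - (v == ehead G e)%:R).

Definition weight_mx : 'M[R]_m := diag_mx (\row_e weight G e).

(* The infimum is a minimum whenever d can be routed in G. *)
Definition opt (d : 'cV[R]_n) : \bar R :=
  ereal_inf [set (l1norm (weight_mx *m f))%:E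
            | f in [set f : 'cV[R]_m | incidence_mx *m f = d]]%classic.

Definition oblivious_routing (alpha : R) (Rt : 'M[R]_(m, n)) : Prop :=
  forall d : 'cV[R]_n, proper_demand d ->
    incidence_mx *m (Rt *m d) = d /\
    ((l1norm (weight_mx *m (Rt *m d)))%:E <= alpha%:E * opt d)%E.

Definition joins (e : 'I_m) x y : bool :=
  (etail G e == x) && (ehead G e == y) || (etail G e == y) && (ehead G e == x).

(* Adjacency in the subgraph with nodes S and those edges of F inside S. *)
Definition adj F S : rel 'I_n :=
  fun x y => [&& x \in S, y \in S & [exists e in F, joins e x y]].

(* A walk is given by its first node x and the sequence p of the next nodes.
   At most one edge joins two nodes, so each sum over edges in [step_length]
   and each column [step_flow] has at most one nonzero term. *)
Definition step_length x y : R := \sum_(e | joins e x y) weight G e.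

Definition walk_length x (p : seq 'I_n) : R :=
  \sum_(l <- pairmap step_length x p) l.

Definition step_flow x y : 'cV[R]_m :=
  \col_e (((etail G e == x) && (ehead G e == y))%:R
          - ((etail G e == y) && (ehead G e == x))%:R).

Definition walk_flow x (p : seq 'I_n) : 'cV[R]_m :=
  \sum_(f <- pairmap step_flow x p) f.

(* Distance in the induced subgraph G[S], +oo if there is no walk. *)
Definition dist_in S x y : \bar R :=
  ereal_inf [set (walk_length x p)%:E
            | p in [set p | path (adj [set: 'I_m]%SET S) x p /\ last x p = y]]%classic.

Definition dist : 'I_n -> 'I_n -> \bar R := dist_in [set: 'I_n]%SET.

Definition connected_on F S : bool :=
  [forall x in S, forall y in S, connect (adj F S) x y].

Definition is_tree F S : Prop :=
  [/\ forall e, e \in F -> (etail G e \in S) && (ehead G e \in S),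
      connected_on F S
    & forall p : seq 'I_n, (2 < size p)%N -> ~ ucycle (adj F S) p].

Definition tree_path F S x y (p : seq 'I_n) : Prop :=
  [/\ path (adj F S) x p, last x p = y & uniq (x :: p)].

Definition shortest_path_tree F S c : Prop :=
  [/\ is_tree F S, c \in S
    & forall v p, v \in S -> tree_path F S v c p ->
        (walk_length v p)%:E = dist_in S v c].

(* Partitions of the nodes into connected components with centers; the value
   of the center function matters only on the components. *)
Definition is_clustering
    (P : {set {set 'I_n}} * {ffun {set 'I_n} -> 'I_n}) : bool :=
  [&& finset.partition P.1 [set: 'I_n]%SET,
      [forall S in P.1, connected_on [set: 'I_m]%SET S]
    & [forall S in P.1, P.2 S \in S]].

Definition clustering : Type :=
  {P : {set {set 'I_n}} * {ffun {set 'I_n} -> 'I_n} | is_clustering P}.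
HB.instance Definition _ := Finite.on clustering.

Definition components (P : clustering) : {set {set 'I_n}} := (val P).1.
Definition center (P : clustering) (S : {set 'I_n}) : 'I_n := (val P).2 S.
Definition component (P : clustering) (v : 'I_n) : {set 'I_n} :=
  finset.pblock (components P) v.

(* [CL] is the exponent of the high-probability guarantee of the radius. *)
Definition is_LDD (CL rho alpha : R) (D : fdist R clustering) : Prop :=
  [/\ 1 <= alpha,
      1 - n%:R `^ (- CL) <=
        Pr D [set P | forall S v, S \in components P -> v \in S ->
                (dist_in S (center P S) v <= rho%:E)%E]%classic
    & forall x y : 'I_n,
        ((Pr D [set P | component P x <> component P y]%classic)%:E
           <= (alpha / rho)%:E * dist x y)%E].

Section Procedure.
Variables (imax g : nat).

(* Rounds and samples are indexed from 0. *)
Definition samples := {ffun 'I_imax * 'I_g -> clustering}.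

Variables (w : samples).
(* [q i j v] : path of v to the center of its component in the j-th sample of
   round i; [t v] : path of v to the root of the spanning tree. *)
Variables (q : 'I_imax -> 'I_g -> 'I_n -> seq 'I_n) (t : 'I_n -> seq 'I_n).

Definition round_flow (i : 'I_imax) (d : 'cV[R]_n) : 'cV[R]_m :=
  \sum_(j < g) \sum_v (g%:R^-1 * d v 0) *: walk_flow v (q i j v).

Definition next_demand (i : 'I_imax) (d : 'cV[R]_n) : 'cV[R]_n :=
  \col_u \sum_(j < g)
    \sum_(v | center (w (i, j)) (component (w (i, j)) v) == u) g%:R^-1 * d v 0.

Definition tree_flow (d : 'cV[R]_n) : 'cV[R]_m :=
  \sum_v d v 0 *: walk_flow v (t v).

(* The state is the pair of the current demand and the flow sent so far. *)
Definition round (s : 'cV[R]_n * 'cV[R]_m) (i : 'I_imax) :=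
  (next_demand i s.1, s.2 + round_flow i s.1).

Definition total_flow (d0 : 'cV[R]_n) : 'cV[R]_m :=
  let s := foldl round (d0, 0) (enum 'I_imax) in s.2 + tree_flow s.1.

Definition routing_mx : 'M[R]_(m, n) :=
  \matrix_(e, v) total_flow (delta_mx v 0) e 0.

Fact round_flow_is_linear i : linear (round_flow i).
Proof.
move=> a x y; rewrite /round_flow scaler_sumr -big_split /=.
apply: eq_bigr => j _; rewrite scaler_sumr -big_split /=.
by apply: eq_bigr => v _; rewrite !mxE mulrDr scalerDl mulrCA scalerA.
Qed.

Fact next_demand_is_linear i : linear (next_demand i).
Proof.
move=> a x y; apply/colP => u; rewrite !mxE mulr_sumr -big_split /=.
apply: eq_bigr => j _; rewrite mulr_sumr -big_split /=.
by apply: eq_bigr => v _; rewrite !mxE mulrDr mulrCA.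
Qed.

Fact tree_flow_is_linear : linear tree_flow.
Proof.
move=> a x y; rewrite /tree_flow scaler_sumr -big_split /=.
by apply: eq_bigr => v _; rewrite !mxE scalerDl scalerA.
Qed.

Fact total_flow_is_linear : linear total_flow.
Proof.
move=> a x y; rewrite /total_flow.
have E : forall s1 s2 s3,
    s3 = (a *: s1.1 + s2.1, a *: s1.2 + s2.2) :> 'cV[R]_n * 'cV[R]_m ->
    forall l, foldl round s3 l = (a *: (foldl round s1 l).1 + (foldl round s2 l).1,
                              a *: (foldl round s1 l).2 + (foldl round s2 l).2).
  move=> s1 s2 s3 + l; elim: l s1 s2 s3 => [|i l IH] s1 s2 s3 -> //=.
  apply: IH; rewrite /round /= next_demand_is_linear round_flow_is_linear.
  by rewrite scalerDr addrACA.
rewrite (E (x, 0) (y, 0)) /=; last by rewrite scaler0 addr0.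
by rewrite tree_flow_is_linear scalerDr addrACA.
Qed.

Lemma routing_mxE d : routing_mx *m d = total_flow d.
Proof.
pose L := GRing.isLinear.Build _ _ _ _ total_flow total_flow_is_linear.
pose f : {linear 'cV[R]_n -> 'cV[R]_m} := HB.pack total_flow L.
have Hf z : total_flow z = f z by [].
rewrite [in RHS](matrix_sum_delta d) Hf linear_sum /=.
apply/colP => e; rewrite mxE summxE; apply: eq_bigr => v _.
by rewrite big_ord1 (GRing.scalable_linear total_flow_is_linear) !mxE mulrC.
Qed.

End Procedure.

(* The paths q all run in shortest path trees of the components of P, rooted
   at their centers. *)
Definition center_paths (P : clustering) (q : 'I_n -> seq 'I_n) : Prop :=
  forall S, S \in components P ->
    exists2 F, shortest_path_tree F S (center P S)
             & forall v, v \in S -> tree_path F S v (center P S) (q v).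

Definition spanning_tree_paths (r : 'I_n) (t : 'I_n -> seq 'I_n) : Prop :=
  exists2 T, is_tree T [set: 'I_n]%SET
           & forall v, tree_path T [set: 'I_n]%SET v r (t v).

(* Rt is the linear routing obtained from the samples w, for some choice of
   the shortest path trees, of the spanning tree and of its root. *)
Definition produced (imax g : nat) (w : samples imax g) (Rt : 'M[R]_(m, n)) :
    Prop :=
  exists q r t,
    [/\ forall i j, center_paths (w (i, j)) (q i j),
        spanning_tree_paths r t
      & Rt = routing_mx w q t].

(* Law of the samples when, for every radius r, LDDs are sampled from D r; the
   g samples of round i (from 0) have radius rho ^ (i + 1). *)
Definition sampling (D : R -> fdist R clustering) (rho : R) (imax g : nat) :
    fdist R (samples imax g) :=
  indep_samples (fun ij : 'I_imax * 'I_g => D (rho ^+ ij.1.+1)).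

End Graph.

(* Main.v *)
(* Any flow routing a demand splits it into demands along edges, so it suffices
   to route an edge demand 1_x - 1_y of weight w at cost A w.  Keep the demand
   coupled: after k rounds it is a combination of differences 1_u - 1_v where u
   and v are joined by a walk of length at most w + 4 rho^k.  A pair whose ends
   fall in one component cancels, so the mass of the coupling shrinks in each
   round by the fraction of LDDs separating a pair; by a Chernoff bound and a
   union bound over all pairs of nodes and all rounds, this fraction is at most
   e alpha max(dist(u, v), rho^k) / rho^(k+1) with high probability.  Hence the
   mass after k rounds is at most (5 e alpha)^k w / rho^k, round k+1 costs at
   most 2 rho (5 e alpha)^k w, and the spanning tree, whose paths have length at
   most n^(C+1) <= rho^imax, adds at most 2 (5 e alpha)^imax w. *)

Require Import Defs.
From HB Require Import structures.
From mathcomp Require Import all_boot all_order all_algebra.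
From mathcomp Require Import all_classical all_reals all_analysis.
From mathcomp Require Import ring lra.

Set Implicit Arguments.
Unset Strict Implicit.
Unset Printing Implicit Defensive.

Import Order.TTheory GRing.Theory Num.Theory.
Import numFieldNormedType.Exports.

Local Open Scope classical_set_scope.
Local Open Scope ring_scope.

(** * Finite probability: Markov and union bounds *)

Section FiniteProbability.
Variables (R : realType) (T : finType) (mu : fdist R T).

Lemma PrE (A : set T) : Pr mu A = \sum_x mu x * (x \in A)%:R.
Proof.
rewrite /Pr big_mkcond; apply: eq_bigr => x _.
by case: ifP => _; rewrite ?mulr1 ?mulr0.
Qed.

Lemma Pr_setC (A : set T) : Pr mu (~` A) = 1 - Pr mu A.
Proof.
rewrite !PrE -[X in X - _](Defs.pmf_sum1 mu) -sumrB; apply: eq_bigr => x _.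
by rewrite in_setC; case: (x \in A) => /=; rewrite ?mulr1 ?mulr0 ?subr0 ?subrr.
Qed.

Lemma le_Pr (A B : set T) : A `<=` B -> Pr mu A <= Pr mu B.
Proof.
move=> AB; rewrite !PrE; apply: ler_sum => x _; apply: ler_wpM2l; first exact: Defs.pmf_ge0.
by rewrite ler_nat; case: (boolP (x \in A)) => // /set_mem/AB/mem_set ->.
Qed.

Lemma Pr_markov (A : set T) (X : T -> R) :
  (forall x, 0 <= X x) -> (forall x, A x -> 1 <= X x) ->
  Pr mu A <= \sum_x mu x * X x.
Proof.
move=> X0 X1; rewrite PrE; apply: ler_sum => x _.
apply: ler_wpM2l; first exact: Defs.pmf_ge0.
by case: (boolP (x \in A)) => [/set_mem/X1|].
Qed.

Lemma Pr_setU (A B : set T) : Pr mu (A `|` B) <= Pr mu A + Pr mu B.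
Proof.
rewrite !PrE -big_split /=; apply: ler_sum => x _; rewrite -mulrDr.
apply: ler_wpM2l; first exact: Defs.pmf_ge0; rewrite in_setU.
by do 2 case: (x \in _) => //=; rewrite ?addr0 ?add0r // ler_wpDl.
Qed.

Lemma Pr_exists (I : finType) (A : I -> set T) :
  Pr mu [set x | exists i, A i x] <= \sum_i Pr mu (A i).
Proof.
under eq_bigr do rewrite PrE.
rewrite exchange_big /=; under eq_bigr do rewrite -mulr_sumr.
apply: Pr_markov => [x|x [i Aix]]; first exact: sumr_ge0.
by rewrite (bigD1 i) //= mem_set // ler_wpDr // sumr_ge0.
Qed.

End FiniteProbability.

(** * Independent samples: expectations of products and a Chernoff bound *)

Section IndependentSamples.
Variables (R : realType) (I T : finType) (mu : I -> fdist R T).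

(** Expanding the product of sums on the right gives one term for each joint sample. *)
Lemma indep_expectation (h : I -> T -> R) :
  \sum_w indep_samples mu w * \prod_i h i (w i) =
  \prod_i \sum_x mu i x * h i x.
Proof.
rewrite bigA_distr_bigA /=; apply: eq_bigr => w _.
by rewrite /= /indep_pmf -big_split.
Qed.

Lemma Pr_indep_marginal (i : I) (A : set T) :
  Pr (indep_samples mu) [set w | A (w i)] = Pr (mu i) A.
Proof.
pose h k x : R := if k == i then (x \in A)%:R else 1.
transitivity (\prod_k \sum_x mu k x * h k x).
  rewrite -indep_expectation PrE; apply: eq_bigr => w _; congr (_ * _).
  rewrite (bigD1 i) //= /h eqxx big1 => [|k /negPf ->//]; rewrite mulr1.
  by congr (_%:R); congr nat_of_bool; apply/idP/idP => /set_mem ?; exact/mem_set.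
rewrite (bigD1 i) //= [X in _ * X]big1 /h => [|k /negPf ->].
  by rewrite eqxx mulr1 PrE.
by under eq_bigr do rewrite mulr1; exact: Defs.pmf_sum1.
Qed.

(* The exponential moment with parameter 1, at the threshold e * s. *)
Lemma indep_chernoff (J : pred I) (A : set T) (s : R) :
  \sum_(i | J i) Pr (mu i) A <= s ->
  Pr (indep_samples mu)
    [set w | expR 1 * s < (\sum_(i | J i) (w i \in A)%:R)%R] <= expR (- s).
Proof.
(* Setting the factor to 1 outside [J] turns the exponential of the partial sum into a product over
   all of [I], so independence applies. *)
move=> ps; pose h i x : R := if J i then expR (x \in A)%:R else 1.
have e1 : 0 <= expR 1 - 1 :> R by rewrite subr_ge0; have := @expR_ge1Dx R 1; lra.
have hw w : \prod_i h i (w i) = expR (\sum_(i | J i) (w i \in A)%:R).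
  by rewrite expR_sum [RHS]big_mkcond.
apply: (@le_trans _ _ (\sum_w indep_samples mu w *
    (expR (- (expR 1 * s)) * \prod_i h i (w i)))).
  apply: Pr_markov => [w|w /= /ltW ws]; rewrite hw -expRD ?expR_ge0 //.
  by rewrite -[leLHS]expR0 ler_expR addrC subr_ge0.
under eq_bigr do rewrite mulrCA.
rewrite -mulr_sumr indep_expectation.
(* This split cancels the tilt [expR (- (expR 1 * s))]; what remains to bound is the exponential
   moment, by [expR ((expR 1 - 1) * s)]. *)
have -> : - s = - (expR 1 * s) + (expR 1 - 1) * s by ring.
rewrite expRD ler_pM2l ?expR_gt0 //.
apply: (@le_trans _ _ (expR ((expR 1 - 1) * \sum_(i | J i) Pr (mu i) A))); last first.
  by rewrite ler_expR ler_wpM2l.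
rewrite mulr_sumr expR_sum [leRHS]big_mkcond /=; apply: ler_prod => i _.
rewrite sumr_ge0 /=; last first.
  move=> x _; rewrite mulr_ge0 ?Defs.pmf_ge0 // /h.
  by case: ifP => _ //; exact: expR_ge0.
rewrite /h; case: ifP => _; last by under eq_bigr do rewrite mulr1; rewrite Defs.pmf_sum1.
(* An indicator of probability p has exponential moment 1 + (e - 1) p, at most exp((e - 1) p). *)
apply: le_trans (expR_ge1Dx _).
rewrite PrE mulr_sumr -[X in X + _](Defs.pmf_sum1 (mu i)) -big_split /=.
apply: ler_sum => x _.
by case: (x \in A) => /=; rewrite ?mulr0n ?mulr1n ?expR0; lra.
Qed.

End IndependentSamples.

(** * The l1 norm on column vectors *)

Section L1Norm.
Variables (R : realType) (k : nat).
Implicit Types x y : 'cV[R]_k.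

Lemma l1norm_ge0 x : 0 <= l1norm x.
Proof. exact: sumr_ge0. Qed.

Lemma l1norm0 : l1norm (0 : 'cV[R]_k) = 0.
Proof. by apply: big1 => i _; rewrite mxE normr0. Qed.

Lemma l1normD x y : l1norm (x + y) <= l1norm x + l1norm y.
Proof. by rewrite -big_split; apply: ler_sum => i _; rewrite mxE ler_normD. Qed.

Lemma l1normZ a x : l1norm (a *: x) = `|a| * l1norm x.
Proof. by rewrite mulr_sumr; apply: eq_bigr => i _; rewrite mxE normrM. Qed.

Lemma l1norm_sum (I : Type) (r : seq I) (P : pred I) (F : I -> 'cV[R]_k) :
  l1norm (\sum_(i <- r | P i) F i) <= \sum_(i <- r | P i) l1norm (F i).
Proof.
elim/big_rec2: _ => [|i b x _ le_xb]; first by rewrite l1norm0.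
by apply: le_trans (l1normD _ _) _; rewrite lerD2l.
Qed.

Lemma l1norm_delta v : l1norm (delta_mx v 0 : 'cV[R]_k) = 1.
Proof.
rewrite /l1norm (bigD1 v) //= mxE !eqxx normr1 big1 ?addr0 // => u /negPf uv.
by rewrite mxE uv normr0.
Qed.

End L1Norm.

(** * Walks: length, reversal, cost and incidence of their flows *)

Section Walks.
Variables (R : realType) (n m : nat) (G : wgraph R n m).
Hypothesis weight_ge0 : forall e, 0 <= weight G e.
Implicit Types (x y z v : 'I_n) (p : seq 'I_n) (F : {set 'I_m}) (S : {set 'I_n}).

Lemma l1norm_weight (f : 'cV[R]_m) :
  l1norm (weight_mx G *m f) = \sum_e weight G e * `|f e 0|.
Proof.
apply: eq_bigr => e _.
by rewrite /weight_mx mul_diag_mx !mxE normrM (ger0_norm (weight_ge0 e)).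
Qed.

Lemma joinsC e x y : joins G e x y = joins G e y x.
Proof. by rewrite /joins orbC. Qed.

Lemma joins_inj e f x y : joins G e x y -> joins G f x y -> e = f.
Proof.
have E h : joins G h x y -> [set etail G h; ehead G h]%SET = [set x; y]%SET.
  by case/orP => /andP[/eqP -> /eqP ->] //; rewrite finset.setUC.
by move=> /E Ee /E Ef; apply: (@wgraph_simple _ _ _ G); rewrite Ee Ef.
Qed.

Lemma adjC F S x y : adj G F S x y = adj G F S y x.
Proof.
rewrite /adj andbCA; do 2 congr (_ && _).
by apply: eq_existsb => e; rewrite joinsC.
Qed.

Lemma sub_adj F F' S S' : F \subset F' -> S \subset S' ->
  subrel (adj G F S) (adj G F' S').
Proof.
move=> /fintype.subsetP FF' /fintype.subsetP SS' x y /and3P[/SS' xS /SS' yS].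
case/existsP => e /andP[/FF' eF exy].
by apply/and3P; split=> //; apply/existsP; exists e; rewrite eF.
Qed.

Lemma step_lengthC x y : step_length G x y = step_length G y x.
Proof. by apply: eq_bigl => e; rewrite joinsC. Qed.

Lemma step_length_ge0 x y : 0 <= step_length G x y.
Proof. exact: sumr_ge0. Qed.

Lemma step_length_joins e x y : joins G e x y -> step_length G x y = weight G e.
Proof.
move=> je; rewrite /step_length (bigD1 e) //= big1 ?addr0 // => f /andP[jf].
by rewrite (joins_inj jf je) eqxx.
Qed.

Lemma walk_length_cons x y p :
  walk_length G x (y :: p) = step_length G x y + walk_length G y p.
Proof. by rewrite /walk_length /= big_cons. Qed.

Lemma walk_length_cat x p1 p2 :
  walk_length G x (p1 ++ p2) = walk_length G x p1 + walk_length G (last x p1) p2.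
Proof. by rewrite /walk_length pairmap_cat big_cat. Qed.

Lemma walk_length_ge0 x p : 0 <= walk_length G x p.
Proof.
elim: p x => [|y p IH] x; first by rewrite /walk_length big_nil.
by rewrite walk_length_cons addr_ge0 // step_length_ge0.
Qed.

Lemma walk_length_le (M : R) F S x p :
  (forall e, weight G e <= M) -> path (adj G F S) x p ->
  walk_length G x p <= M *+ size p.
Proof.
move=> wM; elim: p x => [|y p IH] x; first by rewrite /walk_length big_nil.
rewrite walk_length_cons /= mulrS => /andP[/and3P[_ _ /existsP[e /andP[_ exy]]]].
by move=> /IH; apply: lerD; rewrite (step_length_joins exy).
Qed.

Lemma path_rev S x p : path (adj G [set: 'I_m]%SET S) x p ->
  exists p', [/\ path (adj G [set: 'I_m]%SET S) (last x p) p',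
    last (last x p) p' = x & walk_length G (last x p) p' = walk_length G x p].
Proof.
elim: p x => [|y p IH] x /=; first by exists [::].
case/andP => xy /IH[p' [pp' lp' wp']]; exists (rcons p' x); split.
- by rewrite rcons_path pp' lp' adjC.
- by rewrite last_rcons.
- by rewrite -cats1 walk_length_cat wp' lp' !walk_length_cons addrC
    step_lengthC /walk_length big_nil addr0.
Qed.

(** An explicit walk rather than a bound on [dist]: walks can be reversed and concatenated without
    asking whether the infimum is attained. *)
Definition walk_within (x y : 'I_n) (l : R) : Prop := exists p,
  [/\ path (adj G [set: 'I_m]%SET [set: 'I_n]%SET) x p, last x p = y
    & walk_length G x p <= l].

Lemma walk_within_sym x y l : walk_within x y l -> walk_within y x l.
Proof.
by case=> p [/path_rev[p' [? ? wp']] <- wp]; exists p'; rewrite wp'.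
Qed.

Lemma walk_within_trans x y z l l' :
  walk_within x y l -> walk_within y z l' -> walk_within x z (l + l').
Proof.
move=> [p [pp py wp]] [p' [pp' pz wp']]; exists (p ++ p'); split.
- by rewrite cat_path pp py.
- by rewrite last_cat py.
- by rewrite walk_length_cat py lerD.
Qed.

Lemma walk_within_dist x y l : walk_within x y l -> (dist G x y <= l%:E)%E.
Proof.
case=> p [pp py wp]; apply: (@le_trans _ _ (walk_length G x p)%:E); last by rewrite lee_fin.
by apply: ereal_inf_lbound; exists p.
Qed.

Lemma dist_in_sym S x y : dist_in G S x y = dist_in G S y x.
Proof.
suff H u v : (dist_in G S u v <= dist_in G S v u)%E by apply/eqP; rewrite eq_le !H.
apply: ereal_inf_le_tmp => _ [p [/path_rev[p' [pp' lp' wp']] pu] <-].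
by exists p'; rewrite -?pu ?wp' //=.
Qed.

Lemma walk_flow_cons x y p :
  walk_flow G x (y :: p) = step_flow G x y + walk_flow G y p.
Proof. by rewrite /walk_flow /= big_cons. Qed.

Lemma step_flow_cost x y :
  l1norm (weight_mx G *m step_flow G x y) <= step_length G x y.
Proof.
rewrite l1norm_weight /step_length [leRHS]big_mkcond; apply: ler_sum => e _.
rewrite mxE /joins; case: (_ && _); case: (_ && _) => /=;
  by rewrite ?subrr ?subr0 ?sub0r ?normrN ?normr0 ?normr1 ?mulr1 ?mulr0.
Qed.

Lemma walk_flow_cost x p :
  l1norm (weight_mx G *m walk_flow G x p) <= walk_length G x p.
Proof.
elim: p x => [|y p IH] x; first by rewrite /walk_flow /walk_length !big_nil mulmx0 l1norm0.
rewrite walk_flow_cons walk_length_cons mulmxDr.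
by apply: le_trans (l1normD _ _) _; rewrite lerD ?step_flow_cost.
Qed.

Lemma incidence_delta e : incidence_mx G *m delta_mx e 0 =
  delta_mx (etail G e) 0 - delta_mx (ehead G e) 0 :> 'cV[R]_n.
Proof. by rewrite -colE; apply/colP => v; rewrite !mxE !eqxx !andbT. Qed.

Lemma incidence_step F S x y : adj G F S x y ->
  incidence_mx G *m step_flow G x y = delta_mx x 0 - delta_mx y 0 :> 'cV[R]_n.
Proof.
case/and3P => _ _ /existsP[e /andP[_ je]].
have xy : x != y.
  apply: contraTneq je => ->; apply: contra (wgraph_loopless G e).
  by rewrite /joins orbb => /andP[/eqP -> /eqP ->].
(* In a simple graph [e] is the only edge joining [x] and [y], so the flow has a single nonzero
   entry, whose sign depends on the orientation of [e]. *)
have -> : step_flow G x y = step_flow G x y e 0 *: delta_mx e 0.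
  apply/colP => f; rewrite !mxE eqxx andbT.
  have [->|fe] := eqVneq f e; first by rewrite mulr1.
  have := contra_neqN (fun jf => joins_inj jf je) fe.
  by rewrite negb_or mulr0 => /andP[/negPf -> /negPf ->]; rewrite subrr.
rewrite -scalemxAr incidence_delta mxE; case/orP: je => /andP[/eqP -> /eqP ->].
  by rewrite !eqxx (negPf xy) /= subr0 scale1r.
by rewrite !eqxx (negPf xy) andbF /= sub0r scaleN1r opprB.
Qed.

Lemma incidence_walk F S x p : path (adj G F S) x p ->
  incidence_mx G *m walk_flow G x p = delta_mx x 0 - delta_mx (last x p) 0 :> 'cV[R]_n.
Proof.
elim: p x => [|y p IH] x /=; first by rewrite /walk_flow big_nil mulmx0 subrr.
case/andP => xy yp; rewrite walk_flow_cons mulmxDr (incidence_step xy) (IH _ yp).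
by rewrite addrA subrK.
Qed.

End Walks.

(** * The procedure on fixed samples: conservation, coupling and cost *)

Section Procedure.
Variables (R : realType) (n m : nat) (G : wgraph R n m).
Hypothesis weight_ge0 : forall e, 0 <= weight G e.
Implicit Types (x y v : 'I_n) (d : 'cV[R]_n).

Lemma proper_incidence (f : 'cV[R]_m) : proper_demand (incidence_mx G *m f).
Proof.
rewrite /proper_demand; under eq_bigr do rewrite mxE.
rewrite exchange_big big1 // => e _.
under eq_bigr do rewrite mxE; rewrite -mulr_suml sumrB.
by rewrite -!natr_sum -!big_mkcond /= !big_pred1_eq subrr mul0r.
Qed.

(** By linearity the image of B f is the combination, with coefficients [f e 0], of the images of
    edge demands; the triangle inequality then compares its cost with that of f. *)
Lemma oblivious_routing_edges (A : R) (Rt : 'M[R]_(m, n)) : 0 < A ->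
  (forall d, proper_demand d -> incidence_mx G *m (Rt *m d) = d) ->
  (forall e, l1norm (weight_mx G *m (Rt *m (incidence_mx G *m delta_mx e 0)))
     <= A * weight G e) ->
  oblivious_routing G A Rt.
Proof.
move=> A0 cons edge d pd; split; first exact: cons.
(* With [A] moved to the left, the bound on the infimum is checked on each flow [f] routing [d]. *)
rewrite -lee_pdivrMl //; apply/ereal_infP => _ [f fd <-].
rewrite lee_pdivrMl // -EFinM lee_fin -fd.
have fE : f = \sum_e f e 0 *: delta_mx e 0.
  by rewrite {1}(matrix_sum_delta f); apply: eq_bigr => e _; rewrite big_ord1.
rewrite {1}fE !mulmx_sumr; apply: le_trans (l1norm_sum _ _ _) _.
rewrite l1norm_weight // mulr_sumr; apply: ler_sum => e _.
by rewrite -!scalemxAr l1normZ mulrA mulrC ler_wpM2r.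
Qed.

Lemma mem_component (P : clustering G) v : v \in component P v.
Proof.
have /and3P[/and3P[/eqP covP _ _] _ _] := valP P.
by rewrite /component mem_pblock /components covP finset.in_setT.
Qed.

Lemma component_mem (P : clustering G) v : component P v \in components P.
Proof.
have /and3P[/and3P[/eqP covP _ _] _ _] := valP P.
by apply: pblock_mem; rewrite /components covP finset.in_setT.
Qed.

(** Paths are weakened to the whole graph, where incidence is computed. The distance is read from
    the center, as in the radius guarantee of an LDD, while shortest path trees measure towards
    it. *)
Lemma center_pathsP (P : clustering G) (q : 'I_n -> seq 'I_n) v :
  center_paths P q ->
  [/\ path (adj G [set: 'I_m]%SET [set: 'I_n]%SET) v (q v),
      last v (q v) = Defs.center P (component P v)
    & (walk_length G v (q v))%:E =
        dist_in G (component P v) (Defs.center P (component P v)) v].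
Proof.
move=> /(_ _ (component_mem P v))[F [treeF cS short] /(_ _ (mem_component P v)) tq].
have [pq lq _] := tq; split=> //.
  by apply: sub_path pq; apply: sub_adj; rewrite finset.subsetT.
by rewrite dist_in_sym; apply: short tq; exact: mem_component.
Qed.

Variables (imax g : nat) (w : samples G imax g).
Variables (q : 'I_imax -> 'I_g -> 'I_n -> seq 'I_n) (t : 'I_n -> seq 'I_n).
Variable r : 'I_n.
Hypothesis g_gt0 : (0 < g)%N.
Hypothesis q_center : forall i j, center_paths (w (i, j)) (q i j).
Hypothesis t_tree : spanning_tree_paths G r t.

Local Notation B := (incidence_mx G).
Local Notation W := (weight_mx G).
Local Notation "\delta_ v" := (delta_mx v 0 : 'cV[R]_n)
  (at level 8, v at level 2, format "\delta_ v").
Let ctr i j v := Defs.center (w (i, j)) (component (w (i, j)) v).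

Let gV_ge0 : 0 <= g%:R^-1 :> R. Proof. by rewrite invr_ge0. Qed.

Let gVg : g%:R * g%:R^-1 = 1 :> R.
Proof. by rewrite divff // pnatr_eq0 -lt0n. Qed.

Lemma colE_delta d : d = \sum_v d v 0 *: \delta_v.
Proof.
by rewrite {1}(matrix_sum_delta d); apply: eq_bigr => v _; rewrite big_ord1.
Qed.

(** The definition groups the shares by receiver; grouping by sender matches [round_flow] term by
    term. *)
Lemma next_demandE i d :
  next_demand w i d = \sum_(j < g) \sum_v (g%:R^-1 * d v 0) *: \delta_(ctr i j v).
Proof.
apply/colP => u; rewrite !mxE summxE; apply: eq_bigr => j _.
rewrite summxE big_mkcond; apply: eq_bigr => v _.
by rewrite !mxE eqxx andbT eq_sym; case: eqP; rewrite ?mulr1 ?mulr0.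
Qed.

Lemma next_demand_delta i v :
  next_demand w i \delta_v = \sum_(j < g) g%:R^-1 *: \delta_(ctr i j v).
Proof.
rewrite next_demandE; apply: eq_bigr => j _; rewrite (bigD1 v) //= big1.
  by rewrite mxE !eqxx mulr1 addr0.
by move=> u /negPf uv; rewrite mxE uv mulr0 scale0r.
Qed.

Lemma incidence_round_flow i d :
  B *m round_flow G q i d = d - next_demand w i d.
Proof.
rewrite next_demandE /round_flow mulmx_sumr.
have dE : d = \sum_(j < g) \sum_v (g%:R^-1 * d v 0) *: \delta_v.
  rewrite exchange_big {1}(colE_delta d); apply: eq_bigr => v _ /=.
  by rewrite sumr_const card_ord -scaler_nat scalerA mulrA gVg mul1r.
rewrite [X in _ = X - _]dE -sumrB; apply: eq_bigr => j _.
rewrite mulmx_sumr -sumrB.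
apply: eq_bigr => v _; rewrite -scalemxAr -scalerBr; congr (_ *: _).
have [pq lq _] := center_pathsP v (@q_center i j).
by rewrite (incidence_walk pq) lq.
Qed.

Lemma incidence_tree_flow d : proper_demand d -> B *m tree_flow G t d = d.
Proof.
move=> pd; have [T _ tT] := t_tree; rewrite [RHS]colE_delta mulmx_sumr.
transitivity (\sum_v (d v 0 *: \delta_v - d v 0 *: \delta_r)).
  apply: eq_bigr => v _; have [pv lv _] := tT v.
  by rewrite -scalemxAr (incidence_walk pv) lv scalerBr.
by rewrite sumrB -scaler_suml pd scale0r subr0.
Qed.

Lemma incidence_total_flow d :
  proper_demand d -> B *m total_flow w q t d = d.
Proof.
move=> pd; rewrite /total_flow.
(* Loop invariant: the demand already routed plus the demand still pending is [d]. *)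
have : (B *m (d, 0 : 'cV[R]_m).2 + (d, 0 : 'cV[R]_m).1 = d).
  by rewrite mulmx0 add0r.
elim: (enum 'I_imax) (d, 0 : 'cV[R]_m) => [|i l IH] s /= sd; last first.
  by apply: IH; rewrite /= mulmxDr incidence_round_flow -addrA subrK.
(* The pending demand is [d] minus an incidence image, both proper, so the tree can route it with
   nothing left at the root. *)
have ps : proper_demand s.1.
  have -> : s.1 = d - B *m s.2 by rewrite -[X in X - _]sd addrC addKr.
  rewrite /proper_demand; under eq_bigr do rewrite 2!mxE.
  by rewrite sumrB pd proper_incidence subr0.
by rewrite mulmxDr incidence_tree_flow.
Qed.

Lemma round_flow_cost i d (l : R) :
  (forall j v, walk_length G v (q i j v) <= l) ->
  l1norm (W *m round_flow G q i d) <= l * l1norm d.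
Proof.
move=> ql; rewrite /round_flow mulmx_sumr; apply: le_trans (l1norm_sum _ _ _) _.
have -> : l * l1norm d = \sum_(j < g) g%:R^-1 * l * l1norm d.
  by rewrite sumr_const card_ord -[RHS]mulr_natl !mulrA gVg mul1r.
apply: ler_sum => j _; rewrite mulmx_sumr; apply: le_trans (l1norm_sum _ _ _) _.
rewrite mulr_sumr; apply: ler_sum => v _.
rewrite -scalemxAr l1normZ normrM (ger0_norm gV_ge0) [leRHS]mulrAC.
by rewrite ler_wpM2l ?mulr_ge0 //; apply: le_trans (walk_flow_cost _ _ _) (ql j v).
Qed.

Lemma tree_flow_cost d (l : R) :
  (forall v, walk_length G v (t v) <= l) ->
  l1norm (W *m tree_flow G t d) <= l * l1norm d.
Proof.
move=> tl; rewrite /tree_flow mulmx_sumr; apply: le_trans (l1norm_sum _ _ _) _.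
rewrite mulr_sumr; apply: ler_sum => v _; rewrite -scalemxAr l1normZ mulrC.
by rewrite ler_wpM2r //; apply: le_trans (walk_flow_cost _ _ _) (tl v).
Qed.

Lemma tree_path_length (M : R) v : (forall e, weight G e <= M) -> 0 <= M ->
  walk_length G v (t v) <= n%:R * M.
Proof.
move=> wM M0; have [T _ /(_ v)[pv _ uv]] := t_tree.
apply: le_trans (walk_length_le wM pv) _; rewrite mulr_natl; apply: ler_wpMn2l => //.
have := card_uniqP uv; rewrite /= => E.
by apply: ltnW; rewrite -E -[leqRHS]card_ord max_card.
Qed.

(** [P] is a coupling, or transport plan, for [d]: mass at most [M], carried by pairs joined by
    walks of length at most [l]. *)
Definition spread (l M : R) (d : 'cV[R]_n) : Prop :=
  exists P : 'I_n * 'I_n -> R,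
  [/\ forall p, 0 <= P p,
      d = \sum_p P p *: (\delta_(p.1) - \delta_(p.2)),
      forall p, P p != 0 -> walk_within G p.1 p.2 l
    & \sum_p P p <= M].

Lemma spread_ge0 l M d : spread l M d -> 0 <= M.
Proof. by case=> P [P0 _ _ le_PM]; apply: le_trans le_PM; exact: sumr_ge0. Qed.

Lemma spread_l1norm l M d : spread l M d -> l1norm d <= 2 * M.
Proof.
case=> P [P0 -> _ le_PM]; apply: le_trans (l1norm_sum _ _ _) _.
apply: (@le_trans _ _ (2 * \sum_p P p)); last by rewrite ler_wpM2l.
rewrite mulr_sumr; apply: ler_sum => p _; rewrite l1normZ ger0_norm // mulrC.
rewrite ler_wpM2r //; apply: le_trans (l1normD _ _) _.
by rewrite -scaleN1r l1normZ normrN normr1 mul1r !l1norm_delta.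
Qed.

(** Each sample moves the pair (x, y) to the pair of its centers, with a share 1/g of the mass.
    Pairs in one component cancel, so only the separated fraction, at most [s], survives. *)
Lemma spread_next_demand (i : 'I_imax) (l l' s M : R) d :
  0 <= s ->
  (forall j v, walk_length G v (q i j v) <= l') ->
  (forall x y, walk_within G x y l ->
     \sum_(j < g) (component (w (i, j)) x != component (w (i, j)) y)%:R
       <= g%:R * s) ->
  spread l M d -> spread (l + 2 * l') (M * s) (next_demand w i d).
Proof.
move=> s0 ql seps [P [P0 dE Pl PM]].
pose sep (p : 'I_n * 'I_n) j : R :=
  (component (w (i, j)) p.1 != component (w (i, j)) p.2)%:R.
(* The factor [sep] drops the cancelling pairs from the new coupling; without it the mass would not
   decrease. *)
pose a p j := P p * (g%:R^-1 * sep p j).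
have a0 p j : 0 <= a p j by rewrite !mulr_ge0.
pose c (p : 'I_n * 'I_n) j := (ctr i j p.1, ctr i j p.2).
exists (fun p' => \sum_p \sum_(j < g) a p j * (p' == c p j)%:R); split.
- by move=> p'; do 2 apply: sumr_ge0 => ? _; rewrite mulr_ge0.
- pose L := GRing.isLinear.Build _ _ _ _ _ (next_demand_is_linear w i).
  pose f : {linear 'cV[R]_n -> 'cV[R]_n} := HB.pack (next_demand w i) L.
  have fE z : next_demand w i z = f z by [].
  transitivity (\sum_p \sum_(j < g) a p j *: (\delta_((c p j).1) - \delta_((c p j).2))).
    rewrite dE fE linear_sum; apply: eq_bigr => p _.
    rewrite linearZ linearB -!fE !next_demand_delta -sumrB /= scaler_sumr.
    apply: eq_bigr => j _; rewrite -scalerBr scalerA /a /sep /c /ctr /=.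
    by case: eqP => [->|_]; rewrite ?subrr ?scaler0 // mulr1.
  under [RHS]eq_bigr do rewrite scaler_suml.
  rewrite [RHS]exchange_big; apply: eq_bigr => p _ /=.
  under [RHS]eq_bigr do rewrite scaler_suml.
  rewrite [RHS]exchange_big; apply: eq_bigr => j _ /=.
  rewrite [RHS](bigD1 (c p j)) //= eqxx mulr1 big1 ?addr0 // => p' /negPf ->.
  by rewrite mulr0 scale0r.
- move=> p' nz.
  have [p [j [Pp0 ->]]] : exists p j, P p != 0 /\ p' = c p j.
    apply: contrapT => none; move: nz; rewrite big1 ?eqxx // => p _.
    rewrite big1 // => j _; have [E|] := eqVneq p' (c p j); last by rewrite mulr0.
    rewrite /a; have [->|Pp0] := eqVneq (P p) 0; first by rewrite !mul0r.
    by exfalso; apply: none; exists p, j.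
  have vc v : walk_within G v (ctr i j v) l'.
    (* Both centers are reached from their nodes by walks of length at most [l']; hence the detour
       center, x, y, center. *)
    by have [pv lv _] := center_pathsP v (@q_center i j); exists (q i j v).
  have -> : l + 2 * l' = l' + l + l' by ring.
  apply: walk_within_trans (vc _); apply: walk_within_trans (Pl _ Pp0).
  exact/walk_within_sym/vc.
- rewrite exchange_big /=; apply: (@le_trans _ _ (\sum_p P p * s)); last first.
    by rewrite -mulr_suml ler_wpM2r.
  apply: ler_sum => p _; rewrite exchange_big /=.
  have -> : \sum_(j < g) \sum_p' a p j * (p' == c p j)%:R = \sum_(j < g) a p j.
    apply: eq_bigr => j _; rewrite (bigD1 (c p j)) //= eqxx mulr1 big1 ?addr0 //.
    by move=> p' /negPf ->; rewrite mulr0.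
  rewrite -mulr_sumr -mulr_sumr.
  have [->|Pp0] := eqVneq (P p) 0; first by rewrite !mul0r.
  rewrite ler_wpM2l // ler_pdivrMl ?ltr0n //.
  exact/seps/Pl.
Qed.

Variables rho alpha c w0 Tmax : R.
Hypothesis rho_ge2 : 2 <= rho.
Hypothesis alpha_ge1 : 1 <= alpha.
Hypothesis c_ge1 : 1 <= c.
Hypothesis w0_ge1 : 1 <= w0.
Hypothesis q_length : forall i j v, walk_length G v (q i j v) <= rho ^+ i.+1.
Hypothesis separation : forall (i : 'I_imax) x y l, rho ^+ i <= l ->
  walk_within G x y l ->
  \sum_(j < g) (component (w (i, j)) x != component (w (i, j)) y)%:R
    <= g%:R * (c * alpha * l / rho ^+ i.+1).

(** The 5 comes from [w0 + 4 * rho ^+ i] being at most five times the larger of [w0] and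
    [rho ^+ i]. *)
Let kappa := 5 * (c * alpha).

Let rho_gt0 : 0 < rho. Proof. by apply: lt_le_trans rho_ge2. Qed.
Let ca_ge1 : 1 <= c * alpha. Proof. by rewrite -[1]mulr1 ler_pM. Qed.
Let kappa_ge1 : 1 <= kappa. Proof. by have := ca_ge1; rewrite /kappa; lra. Qed.

(** Two mass bounds are carried: while [rho ^+ i] is below [w0] the geometric one is too weak to
    iterate, and M <= 1 takes its place. *)
Lemma spread_round (i : 'I_imax) M d :
  M <= 1 -> M <= kappa ^+ i * w0 / rho ^+ i -> spread (w0 + 4 * rho ^+ i) M d ->
  exists M', [/\ M' <= 1, M' <= kappa ^+ i.+1 * w0 / rho ^+ i.+1
    & spread (w0 + 4 * rho ^+ i.+1) M' (next_demand w i d)].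
Proof.
move=> M1 Mk sp; have M0 := spread_ge0 sp.
have [[rho0 ca1] [k1 w1]] := (rho_gt0, ca_ge1, (kappa_ge1, w0_ge1)).
have ri0 : 0 < rho ^+ i by rewrite exprn_gt0.
have rS0 : 0 < rho ^+ i.+1 by rewrite exprn_gt0.
pose s := c * alpha * (w0 + 4 * rho ^+ i) / rho ^+ i.+1.
have ca0 : 0 < c * alpha by apply: lt_le_trans ca1.
have wr0 : 0 < w0 + 4 * rho ^+ i by lra.
have s0 : 0 <= s by rewrite /s divr_ge0 ?(ltW rS0) // ltW // mulr_gt0.
(* At most all [g] samples separate a pair, so the fraction can be capped at 1 and the mass never
   grows. *)
pose s1 := Num.min 1 s.
have s10 : 0 <= s1 by rewrite le_min ler01.
exists (M * s1); split.
- by rewrite -[leRHS]mulr1 ler_pM // ge_min lexx.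
(* If [w0] is at most [rho ^+ i], the pair length is at most [5 * rho ^+ i] and the mass shrinks by
   the factor [kappa / rho]. *)
- have [le_w|lt_w] := leP w0 (rho ^+ i).
    have -> : kappa ^+ i.+1 * w0 / rho ^+ i.+1 =
        (kappa ^+ i * w0 / rho ^+ i) * (kappa / rho).
      by rewrite !exprS; field; rewrite !gt_eqF.
    rewrite ler_pM // ge_min; apply/orP; right.
    have kE : kappa / rho * rho ^+ i.+1 = c * alpha * (5 * rho ^+ i).
      by rewrite /kappa exprS; field; rewrite gt_eqF.
    by rewrite /s ler_pdivrMr // kE ler_pM2l //; lra.
  (* Otherwise the length is at most [5 * w0], and M <= 1 alone gives the new bound, with [kappa] in
     place of its power. *)
  apply: (@le_trans _ _ s).
    by rewrite -[leRHS]mul1r ler_pM // ge_min lexx orbT.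
  rewrite ler_pM2r ?invr_gt0 //.
  have ki1 : 1 <= kappa ^+ i by rewrite exprn_ege1.
  apply: (@le_trans _ _ (kappa * w0)).
    have -> : kappa * w0 = c * alpha * (5 * w0) by rewrite /kappa; ring.
    by rewrite ler_pM2l //; lra.
  by rewrite ler_pM2r ?exprS ?ler_peMr //; lra.
have [P [P0 dE Pl PM]] : spread (w0 + 4 * rho ^+ i + 2 * rho ^+ i.+1) (M * s1)
    (next_demand w i d).
  apply: spread_next_demand sp => // x y xy; rewrite minr_pMr ?ler0n // le_min.
  rewrite separation ?andbT //; last by have := ltW ri0; lra.
  rewrite mulr1 -[g in leRHS]card_ord -sum1_card natr_sum.
  by apply: ler_sum => j _; case: (_ != _).
exists P; split=> // p /Pl[p' [pp pl pw]]; exists p'; split=> //.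
(* The constant 4 reproduces itself: since 2 <= rho, [4 * rho ^+ i + 2 * rho ^+ i.+1] is at most
   [4 * rho ^+ i.+1]. *)
apply: le_trans pw _; rewrite exprS.
have : 2 * rho ^+ i <= rho * rho ^+ i by rewrite ler_pM2r.
lra.
Qed.

Let A := 2 * (imax%:R * rho + 1) * kappa ^+ imax.

Lemma total_flow_cost e : weight G e = w0 ->
  (forall v, walk_length G v (t v) <= Tmax) -> Tmax <= rho ^+ imax ->
  l1norm (W *m total_flow w q t (B *m delta_mx e 0)) <= A * w0.
Proof.
move=> we tT Trho.
(* A uniform bound on the cost of one round: the path length [rho ^+ k.+1] times twice the mass
   after [k] rounds leaves a single factor [rho]. *)
pose K := 2 * rho * kappa ^+ imax * w0; have w1 := w0_ge1.
have kle k : (k <= imax)%N -> kappa ^+ k <= kappa ^+ imax.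
  by move=> ?; apply: ler_weXn2l.
have inv k : (k <= imax)%N ->
    let s := foldl (round w q) (B *m delta_mx e 0, 0) (take k (enum 'I_imax)) in
    l1norm (W *m s.2) <= k%:R * K /\
    exists M, [/\ M <= 1, M <= kappa ^+ k * w0 / rho ^+ k
      & spread (w0 + 4 * rho ^+ k) M s.1].
  elim: k => [_|k IH lt_k].
    rewrite take0 /= mulmx0 l1norm0 mul0r; split=> //.
    (* Initially the coupling is the edge itself with mass 1; the geometric bound then reads 1 <=
       w0. *)
    exists 1; rewrite !expr0 mul1r divr1; split=> //.
    exists (fun p => (p == (etail G e, ehead G e))%:R); split => //.
    - rewrite incidence_delta (bigD1 (etail G e, ehead G e)) //= eqxx scale1r.
      by rewrite big1 ?addr0 // => p /negPf ->; rewrite scale0r.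
    - move=> p; have [-> _|_] := eqVneq p _; last by rewrite eqxx.
      have je : joins G e (etail G e) (ehead G e) by rewrite /joins !eqxx.
      exists [:: ehead G e]; split=> //=.
        rewrite andbT /adj !finset.in_setT /=; apply/existsP; exists e.
        by rewrite finset.in_setT.
      rewrite walk_length_cons (step_length_joins je) we /walk_length big_nil.
      by lra.
    - by rewrite -natr_sum -big_mkcond /= big_pred1_eq.
  have [IH1 [M [M1 Mk sp]]] := IH (ltnW lt_k).
  rewrite (take_nth (Ordinal lt_k)) ?size_enum_ord // -[k in nth _ _ k]/(val (Ordinal lt_k)).
  rewrite nth_ord_enum foldl_rcons.
  move: (foldl _ _ _) IH1 sp => s IH1 sp /=; split; last exact: (@spread_round (Ordinal lt_k) M).
  rewrite mulmxDr -[k.+1]addn1 natrD mulrDl mul1r.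
  apply: le_trans (l1normD _ _) _; apply: lerD => //.
  apply: le_trans (round_flow_cost _ (@q_length (Ordinal lt_k))) _.
  have rS0 : 0 <= rho ^+ k.+1 by rewrite exprn_ge0 // ltW.
  apply: (@le_trans _ _ (rho ^+ k.+1 * (2 * (kappa ^+ k * w0 / rho ^+ k)))).
    by rewrite ler_wpM2l //; apply: le_trans (spread_l1norm sp) _; rewrite ler_wpM2l.
  have -> : rho ^+ k.+1 * (2 * (kappa ^+ k * w0 / rho ^+ k)) = 2 * rho * kappa ^+ k * w0.
    by rewrite exprS; field; rewrite gt_eqF // exprn_gt0.
  rewrite /K; apply: ler_wpM2r; first lra.
  by apply: ler_wpM2l; [have := rho_gt0; lra|exact/kle/ltnW].
have := inv imax (leqnn _).
rewrite /total_flow take_oversize ?size_enum_ord // => -[costs [M [_ Mk sp]]].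
rewrite mulmxDr; apply: le_trans (l1normD _ _) _.
have -> : A * w0 = imax%:R * K + 2 * (kappa ^+ imax * w0) by rewrite /A /K; ring.
apply: lerD costs _; apply: le_trans (tree_flow_cost _ tT) _.
apply: (@le_trans _ _ (rho ^+ imax * (2 * (kappa ^+ imax * w0 / rho ^+ imax)))).
  rewrite ler_pM ?l1norm_ge0 //.
    by apply: le_trans (tT (etail G e)); exact: walk_length_ge0.
  by apply: le_trans (spread_l1norm sp) _; rewrite ler_wpM2l.
have ri0 : rho ^+ imax != 0 by rewrite gt_eqF // exprn_gt0.
by rewrite le_eqVlt; apply/orP; left; apply/eqP; field.
Qed.

End Procedure.

(** * Probability that all samples are good *)

Section GoodSamples.
Variables (R : realType) (n m : nat) (G : wgraph R n m) (imax g : nat).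
Variables (alpha rho : R).

Definition good_radius (w : samples G imax g) : Prop :=
  forall (ij : 'I_imax * 'I_g) S v,
    S \in components (w ij) -> v \in S ->
    (dist_in G S (Defs.center (w ij) S) v <= (rho ^+ ij.1.+1)%:E)%E.

(* From the second round on, the expected number of samples separating two
   nodes at distance o(rho ^ i) is too small for concentration; hence the
   maximum with rho ^ i. *)
Definition separation_bound (i : 'I_imax) (x y : 'I_n) : R :=
  g%:R * (alpha * Num.max (fine (dist G x y)) (rho ^+ i) / rho ^+ i.+1).

(** Infinite distances are excluded because [fine] would send them to 0. *)
Definition good_separation (w : samples G imax g) : Prop :=
  forall (i : 'I_imax) x y, (dist G x y < +oo)%E ->
    \sum_(j < g) (component (w (i, j)) x != component (w (i, j)) y)%:R
      <= expR 1 * separation_bound i x y.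

Variables (a CL : R) (D : R -> fdist R (clustering G)).
Hypothesis rho_gt0 : 0 < rho.
Hypothesis lddD : forall r : R, 0 < r -> is_LDD CL r alpha (D r).

Lemma Pr_bad_radius :
  Pr (sampling D rho imax g) [set w | ~ good_radius w] <=
    (imax * g)%:R * n%:R `^ (- CL).
Proof.
pose good (k : nat) := [set P : clustering G | forall S v,
  S \in components P -> v \in S ->
  (dist_in G S (Defs.center P S) v <= (rho ^+ k.+1)%:E)%E].
apply: (@le_trans _ _ (Pr (sampling D rho imax g)
    [set w | exists ij, (~` good (nat_of_ord ij.1)) (w ij)])).
  apply: le_Pr => w /= bad; apply: contrapT => none; apply: bad => ij S v.
  have /contrapT : ~ ~ good ij.1 (w ij) by move=> b; apply: none; exists ij.
  by apply.
apply: le_trans (Pr_exists _ _) _.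
have -> : (imax * g)%N = #|{: 'I_imax * 'I_g}| by rewrite card_prod !card_ord.
rewrite -sum1_card natr_sum mulr_suml.
apply: ler_sum => ij _; rewrite mul1r.
have -> := Pr_indep_marginal (fun k : 'I_imax * 'I_g => D (rho ^+ k.1.+1)) ij (~` good ij.1).
rewrite Pr_setC lerBlDr addrC -lerBlDr.
by have [] := lddD (exprn_gt0 ij.1.+1 rho_gt0).
Qed.

(** For a fixed round and pair, LDD quality bounds the expected number of separating samples by
    [separation_bound], which is at least [a]. Chernoff gives failure probability at most exp(-a),
    and a union bound covers all rounds and pairs. *)
Lemma Pr_bad_separation : a <= g%:R * (alpha / rho) ->
  Pr (sampling D rho imax g) [set w | ~ good_separation w] <=
    (imax * (n * n))%:R * expR (- a).
Proof.
move=> le_a; pose sep (x y : 'I_n) := [set P : clustering G | component P x <> component P y].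
pose bad (ixy : 'I_imax * ('I_n * 'I_n)) := [set w : samples G imax g |
  (dist G ixy.2.1 ixy.2.2 < +oo)%E /\
  expR 1 * separation_bound ixy.1 ixy.2.1 ixy.2.2 <
    \sum_(k | k.1 == ixy.1) (w k \in sep ixy.2.1 ixy.2.2)%:R].
apply: (@le_trans _ _ (Pr (sampling D rho imax g) [set w | exists ixy, bad ixy w])).
  apply: le_Pr => w /= nsep; apply: contrapT => none; apply: nsep => i x y dxy.
  rewrite leNgt; apply/negP => lt_s; apply: none; exists (i, (x, y)); split=> //=.
  apply: lt_le_trans lt_s _; rewrite le_eqVlt; apply/orP; left; apply/eqP.
  (* The samples of round [i] become the indices [k] with [k.1 == i] in the joint family, the form
     in which Chernoff applies. *)
  transitivity (\sum_(i' | i' == i) \sum_(j < g)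
      ((w (i', j) \in sep x y)%:R : R)).
    rewrite big_pred1_eq; apply: eq_bigr => j _; congr (_%:R); congr nat_of_bool.
    by apply/idP/idP => [/eqP ne|/set_mem/eqP //]; apply/mem_set.
  by rewrite pair_big; apply: eq_big => [[i' j]|[i' j] _] //=; rewrite andbT.
apply: le_trans (Pr_exists _ _) _.
have -> : (imax * (n * n))%N = #|{: 'I_imax * ('I_n * 'I_n)}|.
  by rewrite !card_prod !card_ord.
rewrite -sum1_card natr_sum mulr_suml.
apply: ler_sum => -[i [x y]] _; rewrite mul1r /bad /=.
have [dxy|dxy] := boolP (dist G x y < +oo)%E; last first.
  apply: le_trans (expR_ge0 _); rewrite /Pr big1 // => w /set_mem[/= dfin _].
  by case/negP: dxy.
have [alpha1 _ _] := lddD rho_gt0.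
have ri0 : 0 < rho ^+ i by rewrite exprn_gt0.
have rS0 : 0 < rho ^+ i.+1 by rewrite exprn_gt0.
have alpha0 : 0 <= alpha by apply: le_trans alpha1.
apply: (@le_trans _ _ (expR (- separation_bound i x y))).
  apply: le_trans (le_Pr _ _) (indep_chernoff (J := fun k => k.1 == i) (A := sep x y) _).
    by move=> w /= [].
  apply: (@le_trans _ _ (\sum_(k : 'I_imax * 'I_g | k.1 == i)
      alpha * Num.max (fine (dist G x y)) (rho ^+ i) / rho ^+ i.+1)).
    apply: ler_sum => k /eqP ->; have [_ _ /(_ x y)] := lddD rS0.
    rewrite -lee_fin => /le_trans; apply.
    have dmax : (dist G x y <= (Num.max (fine (dist G x y)) (rho ^+ i))%:E)%E.
      case: (dist G x y) dxy => [z|//|_]; last by rewrite leNye.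
      by rewrite /= lee_fin le_max lexx.
    have ar : 0 <= alpha / rho ^+ i.+1 by rewrite divr_ge0 // ltW.
    apply: le_trans (lee_wpmul2l _ dmax) _; first by rewrite lee_fin.
    by rewrite -EFinM lee_fin mulrAC.
  set X := (_ / _); have -> : \sum_(k : 'I_imax * 'I_g | k.1 == i) X =
      \sum_(i' | i' == i) \sum_(j < g) X.
    by rewrite pair_big; apply: eq_bigl => k; rewrite andbT.
  by rewrite big_pred1_eq sumr_const card_ord -mulr_natl.
(* The maximum with [rho ^+ i] keeps the exponent above [g%:R * (alpha / rho)], whatever the
   pair. *)
rewrite ler_expR lerN2; apply: le_trans le_a _; rewrite ler_wpM2l //.
rewrite -mulrA ler_wpM2l // ler_pdivlMr // exprS mulrA mulVf ?gt_eqF // mul1r.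
by rewrite le_max lexx orbT.
Qed.

(** There are at most n^2 radius events of probability n^-(b+3) and n^3 separation events of
    probability n^-(b+4). Each family contributes at most n^-b / n, and 2 / n <= 1. *)
Lemma Pr_good_samples (b : R) :
  CL = b + 3 -> a = (b + 4) * ln n%:R -> a <= g%:R * (alpha / rho) ->
  (2 <= n)%N -> (imax <= n)%N -> (g <= n)%N ->
  1 - n%:R `^ (- b) <=
    Pr (sampling D rho imax g) [set w | good_radius w /\ good_separation w].
Proof.
move=> CLE aE le_a n2 le_in le_gn.
set good := [set w | _]; rewrite -[good]setCK Pr_setC lerD2l lerN2.
have n0 : 0 < n%:R :> R by rewrite ltr0n ltnW.
apply: (@le_trans _ _ (Pr (sampling D rho imax g)
    ([set w | ~ good_radius w] `|` [set w | ~ good_separation w]))).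
  by apply: le_Pr => w /not_andP[]; [left|right].
apply: le_trans (Pr_setU _ _ _) _.
have nn0 : n%:R != 0 :> R by rewrite gt_eqF.
have pE k : n%:R ^+ k * n%:R `^ (- (b + k.+1%:R)) = n%:R `^ (- b) / n%:R :> R.
  rewrite -powR_mulrn ?ltW // -powRD ?nn0 ?implybT //.
  rewrite -[X in _ / X]powRr1 ?ltW // -powRB ?nn0 ?implybT //.
  by congr (_ `^ _); rewrite -natr1; ring.
apply: (@le_trans _ _ (n%:R `^ (- b) / n%:R + n%:R `^ (- b) / n%:R)); last first.
  rewrite -mulr2n -mulrnAr ler_piMr ?powR_ge0 // -mulr_natl ler_pdivrMr //.
  by rewrite mul1r ler_nat.
apply: lerD.
  apply: le_trans Pr_bad_radius _; rewrite CLE -(pE 2%N) ler_wpM2r ?powR_ge0 //.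
  by rewrite -natrX ler_nat expnS expn1 leq_mul.
apply: le_trans (Pr_bad_separation le_a) _; rewrite -(pE 3%N).
have -> : expR (- a) = n%:R `^ (- (b + 4)) :> R.
  by rewrite /powR gt_eqF // aE mulNr.
rewrite ler_wpM2r ?powR_ge0 // -natrX ler_nat !expnS expn0 muln1.
by rewrite leq_mul2r le_in orbT.
Qed.

End GoodSamples.

(** The deterministic half: good samples supply the path lengths and the separation hypothesis, with
    c = e, for the cost of edge demands. *)
Lemma good_samples_oblivious (R : realType) (n m : nat) (G : wgraph R n m)
    (imax g : nat) (alpha rho C A : R) (w : samples G imax g) (Rt : 'M[R]_(m, n)) :
  (0 < n)%N -> (0 < g)%N -> 1 <= alpha -> 2 <= rho ->
  n%:R `^ (C + 1) <= rho ^+ imax ->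
  (forall e, 1 <= weight G e <= n%:R `^ C) ->
  produced w Rt -> good_radius rho w -> good_separation alpha rho w ->
  2 * (imax%:R * rho + 1) * (5 * (expR 1 * alpha)) ^+ imax <= A -> 0 < A ->
  oblivious_routing G A Rt.
Proof.
move=> n0 g0 alpha1 rho2 n_rho wG [q [r [t [cq tt ->]]]] rad sep le_A A0.
have w0 e : 0 <= weight G e by case/andP: (wG e) => + _; apply: le_trans.
have rho0 : 0 < rho by apply: lt_le_trans rho2.
have e1 : 1 <= expR 1 :> R by have := @expR_ge1Dx R 1; lra.
apply: oblivious_routing_edges => // [d pd|e].
  by rewrite routing_mxE (incidence_total_flow g0 cq tt).
rewrite routing_mxE; have /andP[we1 _] := wG e.
apply: (@le_trans _ _ (2 * (imax%:R * rho + 1) * (5 * (expR 1 * alpha)) ^+ imax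
    * weight G e)); last by rewrite ler_wpM2r.
apply: (total_flow_cost w0 g0 cq (Tmax := n%:R * n%:R `^ C)) => //.
- move=> i j v; have [_ _ qE] := center_pathsP v (cq i j).
  rewrite -lee_fin qE; apply: (rad (i, j)); first exact: component_mem.
  exact: mem_component.
- move=> i x y l le_l xy.
  (* The walk makes the distance finite and at most [l]; since [rho ^+ i] is at most [l] too, [l]
     dominates the maximum in [separation_bound]. *)
  have dl := walk_within_dist xy.
  apply: le_trans (sep i x y (le_lt_trans dl (ltry _))) _.
  rewrite /separation_bound mulrCA ler_wpM2l // !mulrA ler_wpM2r //.
    by rewrite invr_ge0 exprn_ge0 // ltW.
  rewrite ler_wpM2l ?mulr_ge0 ?expR_ge0 //; first exact: le_trans alpha1.
  rewrite ge_max le_l andbT.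
  case: (dist G x y) dl => [z|//|_] /=; first by rewrite lee_fin.
  by apply: le_trans le_l; rewrite exprn_ge0 // ltW.
- move=> v; apply: (tree_path_length tt); last exact: powR_ge0.
  by move=> f; case/andP: (wG f).
- apply: le_trans n_rho; rewrite powRD ?pnatr_eq0 -?lt0n ?n0 ?implybT //.
  by rewrite powRr1 // mulrC.
Qed.

(** * Asymptotics of the parameters *)

Section Asymptotics.
Variable R : realType.

Let L (n : nat) : R := ln n%:R.
(** [s] and [h] are the orders of the exponents of [alpha] and [rho]; [h] is also that of the final
    quality. *)
Let s (n : nat) : R := Num.sqrt (L n * ln (L n)).
Let h (n : nat) : R := (L n * ln (L n)) `^ (3 / 4).

(** With y = (ln n)^(1/8) all comparisons become polynomial in y. The bound [y ^+ 2 * s n <= h n]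
    keeps alpha^imax within exp(O(h)), and [h n <= 8 * y ^+ 7] makes [rho] smaller than any power of
    n. *)
Lemma near_log_scales (M : R) : \forall n \near \oo, exists y : R,
  [/\ M <= y, L n = y ^+ 8, L n `^ (1 / 4) = y ^+ 2
    & [/\ 1 <= s n, y ^+ 2 * s n <= h n & h n <= 8 * y ^+ 7]].
Proof.
(* The maximum with e ensures ln n >= e, hence ln ln n >= 1. *)
pose M1 := Num.max M (expR 1).
near=> n.
have e1 : 1 <= expR 1 :> R by have := @expR_ge1Dx R 1; lra.
have M1e : expR 1 <= M1 by rewrite le_max lexx orbT.
have nM : expR (M1 ^+ 8) <= n%:R.
  by near: n; exact: nbhs_infty_ger.
have n0 : 0 < n%:R :> R by apply: lt_le_trans nM; exact: expR_gt0.
have LM : M1 ^+ 8 <= L n by rewrite /L -[leLHS]expRK ler_ln // posrE expR_gt0.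
have L0 : 0 <= L n by apply: le_trans LM; rewrite exprn_ge0 //; lra.
pose y := L n `^ (1 / 8); exists y.
have y0 : 0 <= y by exact: powR_ge0.
have yM : M1 <= y.
  have -> : M1 = (M1 ^+ 8) `^ (1 / 8).
    rewrite -powR_mulrn; last lra.
    rewrite -powRrM (_ : 8%:R * (1 / 8) = 1); last by field.
    by rewrite powRr1 //; lra.
  by rewrite ge0_ler_powR // ?nnegrE ?exprn_ge0 //; lra.
have Ly : L n = y ^+ 8.
  rewrite -powR_mulrn // -powRrM (_ : 1 / 8 * 8%:R = 1); last by field.
  by rewrite powRr1.
have y1 : 1 <= y by lra.
have Le : expR 1 <= L n.
  rewrite Ly; apply: (@le_trans _ _ y); first lra.
  by rewrite -[leLHS]expr1 ler_weXn2l.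
have Lgt0 : 0 < L n by lra.
have LL1 : 1 <= ln (L n).
  by rewrite -[leLHS](expRK (R := R)) ler_ln // posrE expR_gt0.
have L14 : L n `^ (1 / 4) = y ^+ 2.
  by rewrite -powR_mulrn // -powRrM; congr (_ `^ _); lra.
have LLL1 : 1 <= L n * ln (L n) by rewrite -[leLHS]mulr1 ler_pM //; lra.
have s1 : 1 <= s n by rewrite /s -[leLHS]sqrtr1 ler_sqrt //; lra.
split=> //; first by apply: le_trans yM; rewrite le_max lexx.
split=> //.
- have -> : h n = (L n * ln (L n)) `^ (1 / 4) * s n.
    rewrite /s -powR12_sqrt; last lra.
    rewrite -powRD; last by apply/implyP => _; rewrite gt_eqF //; lra.
    by congr (_ `^ _); lra.
  rewrite ler_wpM2r ?sqrtr_ge0 // -L14 ge0_ler_powR ?nnegrE //; try lra.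
  by rewrite ler_peMr.
- have LL8 : ln (L n) <= 8 * y.
    have -> : ln (L n) = 8 * ln y by rewrite ln_powR; field.
    by rewrite ler_pM2l // ltW // ln_sublinear //; lra.
  apply: (@le_trans _ _ ((8 * y ^+ 9) `^ (3 / 4))).
    rewrite ge0_ler_powR ?nnegrE //; try lra.
      by rewrite mulr_ge0 // exprn_ge0.
    have -> : 8 * y ^+ 9 = L n * (8 * y) by rewrite Ly; ring.
    by rewrite ler_pM2l.
  (* The exponent 27/4 of y is rounded up to 7, and 8^(3/4) to 8. *)
  rewrite powRM ?exprn_ge0 // ler_pM ?powR_ge0 //; first by rewrite ler1_powR; lra.
  rewrite -powR_mulrn // -powRrM -powR_mulrn // ler_powR //; lra.
Unshelve. all: by end_near. Qed.

Lemma bigO_bound (f k : nat -> R) : f =O_\oo k ->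
  exists2 K, 0 < K & \forall n \near \oo, `|f n| <= K * `|k n|.
Proof. by move=> /eqO_exP. Qed.

Lemma is_expOZ (K : R) (k : nat -> R) : 0 < K -> is_expO (fun n => expR (K * k n)) k.
Proof.
move=> K0; exists (fun n => K * k n) => //; apply/eqO_exP; exists K => //.
by apply: nearW => n; rewrite normrM gtr0_norm.
Qed.

Lemma near_parameters (C : R) (alpha rho : nat -> R) (imax g : nat -> nat) :
  0 < C -> is_expO alpha s -> is_expO rho h ->
  (fun n => (imax n)%:R : R) =O_\oo (fun n => L n `^ (1 / 4)) ->
  (\forall n \near \oo, (n%:R : R) `^ (C + 1) <= rho n ^+ imax n) ->
  (fun n => (g n)%:R : R) =O_\oo (fun n => L n * (rho n / alpha n)) ->
  exists2 K, 0 < K & \forall n \near \oo,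
  [/\ [/\ (2 <= n)%N, 2 <= rho n & (imax n <= n)%N],
      (1 <= alpha n -> (g n <= n)%N)
    & 2 * ((imax n)%:R * rho n + 1) * (5 * (expR 1 * alpha n)) ^+ imax n
        <= expR (K * h n)].
Proof.
move=> C0 [ua ua_s alphaE] [ur ur_h rhoE] /bigO_bound[Ki Ki0 imaxK] rho_imax.
move=> /bigO_bound[Kg Kg0 gK].
have [Ka Ka0 uaK] := bigO_bound ua_s; have [Kr Kr0 urK] := bigO_bound ur_h.
(* The logarithm of the cost is at most 1 + ln rho + imax (6 + ln alpha): the 6 collects 1 from imax
   + 1 <= e^imax, 4 from 5 <= e^4, and 1 from the factor e. *)
exists (1 + Kr + Ki * (6 + Ka)).
  by rewrite !addr_gt0 // mulr_gt0 // addr_gt0.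
near=> n.
have [y [yM Ly L14 [s1 ys_h hy]]] : exists y : R,
  (* The summand [Ki] makes imax smaller than ln n; the last group makes g at most n. *)
  [/\ 1 + Ki + (Kg + 8 + 8 * Kr) <= y, L n = y ^+ 8, L n `^ (1 / 4) = y ^+ 2
    & [/\ 1 <= s n, y ^+ 2 * s n <= h n & h n <= 8 * y ^+ 7]].
  by near: n; exact: near_log_scales.
have y1 : 1 <= y by lra.
have y0 : 0 <= y by lra.
have y2 : 1 <= y ^+ 2 by rewrite exprn_ege1.
have h1 : 1 <= h n.
  by apply: le_trans ys_h; rewrite -[leLHS]mulr1 ler_pM.
have n1 : (2 <= n)%N.
  rewrite ltnNge -(ler_nat R); apply/negP => /ln_le0; apply/negP.
  by rewrite -ltNge -/(L n) Ly exprn_gt0 //; lra.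
have n0 : 0 < n%:R :> R by rewrite ltr0n ltnW.
have nE : n%:R = expR (L n) by rewrite /L lnK // posrE.
have imax_y : (imax n)%:R <= Ki * y ^+ 2.
  rewrite -L14; have := near imaxK n.
  by rewrite ger0_norm // (ger0_norm (powR_ge0 _ _)); apply.
have Ki_y : Ki * y ^+ 2 < y ^+ 8.
  apply: (@lt_le_trans _ _ (y ^+ 3)); last by rewrite ler_weXn2l.
  by rewrite [ltRHS]exprS ltr_pM2r; lra.
have ua_le : ua n <= Ka * s n.
  have := near uaK n; rewrite (ger0_norm (sqrtr_ge0 _)) => H.
  by apply: le_trans (ler_norm _) (H _).
have ur_le : ur n <= Kr * h n.
  have := near urK n; rewrite (ger0_norm (powR_ge0 _ _)) => H.
  by apply: le_trans (ler_norm _) (H _).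
have e2 : 2 <= expR 1 :> R by have := @expR_ge1Dx R 1; lra.
have rho0 : 0 < rho n by rewrite rhoE expR_gt0.
have rho2 : 2 <= rho n.
  (* The O-bound limits the exponent of [rho] only from above. If rho < 2 <= e, then rho^imax <=
     exp(Ki y^2) < exp(y^8) = n < n^(C+1), against the choice of [imax]. *)
  rewrite leNgt; apply/negP => rho_lt2.
  have : (n%:R : R) `^ (C + 1) <= rho n ^+ imax n by near: n.
  apply/negP; rewrite -ltNge.
  apply: (@le_lt_trans _ _ (expR 1 ^+ imax n)).
    by apply: lerXn2r; rewrite ?nnegrE ?expR_ge0 //; lra.
  rewrite -expRM_natl mulr1 /powR gt_eqF // ltr_expR -/(L n) Ly.
  apply: le_lt_trans imax_y _; apply: lt_trans Ki_y _.
  by rewrite ltr_pMl ?exprn_gt0; lra.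
split; first split=> //.
- rewrite -(ler_nat R); apply: le_trans imax_y _; apply: ltW.
  by apply: lt_trans Ki_y _; rewrite -Ly ln_sublinear.
- move=> alpha1; rewrite -(ler_nat R).
  have := near gK n; rewrite ger0_norm // => /(_ _)/le_trans; apply=> //.
  have LR0 : 0 <= L n * (rho n / alpha n).
    by rewrite !mulr_ge0 ?invr_ge0 ?Ly ?exprn_ge0 ?(ltW rho0) //; lra.
  rewrite ger0_norm //.
  (* Each factor of the bound on g is put under an exponential, using rho / alpha <= rho; the total
     exponent is at most (Kg + 8 + 8 Kr) y^7 <= y^8 = ln n. *)
  apply: (@le_trans _ _ (expR Kg * (expR y ^+ 8 * expR (Kr * h n)))).
    rewrite ler_pM ?(ltW Kg0) //; first by have := @expR_ge1Dx R Kg; lra.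
    rewrite ler_pM //; last 2 first.
    - rewrite Ly; apply: lerXn2r; rewrite ?nnegrE ?expR_ge0 //.
      by have := @expR_ge1Dx R y; lra.
    - rewrite ler_pdivrMr; last lra.
      rewrite -[leLHS]mulr1 ler_pM //; last by rewrite rhoE ler_expR.
      exact: ltW.
    - by rewrite Ly exprn_ge0.
    - by rewrite divr_ge0 ?(ltW rho0) //; lra.
  rewrite -expRM_natl -!expRD nE ler_expR Ly.
  have y7 : 1 <= y ^+ 7 by rewrite exprn_ege1.
  apply: (@le_trans _ _ ((Kg + 8 + 8 * Kr) * y ^+ 7)); last first.
    by rewrite exprS ler_wpM2r ?exprn_ge0 //; lra.
  have yy7 : y <= y ^+ 7 by rewrite -[leLHS]expr1 ler_weXn2l.
  have a1 : Kg <= Kg * y ^+ 7 by rewrite ler_peMr // ltW.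
  have a2 : Kr * h n <= Kr * (8 * y ^+ 7) by rewrite ler_pM2l.
  lra.
- set k := imax n in imax_y *.
  have k0 : 0 <= k%:R :> R by [].
  have ea0 : 0 <= expR 1 * alpha n by rewrite mulr_ge0 ?alphaE ?expR_ge0.
  apply: (@le_trans _ _ (expR 1 * (expR k%:R * expR (ur n)) *
      (expR 4 * (expR 1 * alpha n)) ^+ k)).
    apply: ler_pM.
    + by rewrite mulr_ge0 // addr_ge0 // mulr_ge0 // ltW.
    + by rewrite exprn_ge0 // mulr_ge0.
    + apply: ler_pM => //; first by rewrite addr_ge0 // mulr_ge0 // ltW.
      rewrite -rhoE; apply: (@le_trans _ _ ((1 + k%:R) * rho n)).
        by rewrite mulrDl; lra.
      by rewrite ler_pM2r // expR_ge1Dx.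
    + have e4 : 5 <= expR 4 :> R by have := @expR_ge1Dx R 4; lra.
      apply: lerXn2r; last by rewrite ler_wpM2r.
        by rewrite nnegrE mulr_ge0.
      by rewrite nnegrE mulr_ge0 ?expR_ge0.
  rewrite alphaE -!expRD -expRM_natl -expRD ler_expR.
  have b1 : k%:R * (6 + Ka * s n) <= Ki * y ^+ 2 * ((6 + Ka) * s n).
    rewrite ler_pM //; first by rewrite addr_ge0 // mulr_ge0 ?(ltW Ka0) //; lra.
    by rewrite mulrDl lerD2r ler_peMr.
  have b2 : Ki * (6 + Ka) * (y ^+ 2 * s n) <= Ki * (6 + Ka) * h n.
    by rewrite ler_wpM2l // mulr_ge0 //; lra.
  have b3 : k%:R * ua n <= k%:R * (Ka * s n) by rewrite ler_wpM2l.
  lra.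
Unshelve. all: by end_near. Qed.

End Asymptotics.

Theorem theorem3p5 (R : realType) (C C' : R) (hC : 0 < C) (hC' : 0 < C')
  (alpha rho : nat -> R) (imax : nat -> nat)
  (halpha : is_expO alpha
     (fun n => Num.sqrt (ln (n%:R : R) * ln (ln (n%:R : R)))))
  (hrho : is_expO rho
     (fun n => (ln (n%:R : R) * ln (ln (n%:R : R))) `^ (3 / 4)))
  (himax : (fun n => (imax n)%:R : R) =O_\oo (fun n => ln (n%:R : R) `^ (1 / 4)))
  (hrho_imax : \forall n \near \oo, (n%:R : R) `^ (C + 1) <= rho n ^+ imax n) :
  exists cg CL : R, [/\ 0 < cg, 0 < CL &
  forall g : nat -> nat,
    (\forall n \near \oo,
       cg * ln (n%:R : R) * (rho n / alpha n) <= (g n)%:R) ->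
    (fun n => (g n)%:R : R) =O_\oo
      (fun n => ln (n%:R : R) * (rho n / alpha n)) ->
  exists2 A : nat -> R,
    is_expO A (fun n => (ln (n%:R : R) * ln (ln (n%:R : R))) `^ (3 / 4)) &
    \forall n \near \oo,
      forall (m : nat) (G : wgraph R n m) (D : R -> fdist R (clustering G)),
        (forall e, 1 <= weight G e <= (n%:R : R) `^ C) ->
        (forall r : R, 0 < r -> is_LDD CL r (alpha n) (D r)) ->
        forall Rt : samples G (imax n) (g n) -> 'M[R]_(m, n),
          (forall w, produced w (Rt w)) ->
          1 - (n%:R : R) `^ (- C') <=
            Pr (sampling D (rho n) (imax n) (g n))
               [set w | oblivious_routing G (A n) (Rt w)]%classic].
Proof.
(* These are the exponents of [Pr_good_samples] for b = C': 4 pays for n^3 separation events, 3 for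
   n^2 radius events, each with one factor n to spare. *)
exists (C' + 4), (C' + 3); split; [lra|lra|move=> g g_ge g_O].
have [K K0 near_par] := near_parameters hC halpha hrho himax hrho_imax g_O.
exists (fun n => expR (K * (ln (n%:R : R) * ln (ln (n%:R : R))) `^ (3 / 4))).
  exact: is_expOZ.
near=> n => m G D wG lddD Rt prodRt.
case: (near near_par n) => // -[n2 rho2 imax_n] g_n le_A.
(* The bound 1 <= alpha is part of being an LDD; any positive radius yields it. *)
have /(_ ltr01)[alpha1 _ _] := lddD 1.
have alpha0 : 0 < alpha n by apply: lt_le_trans alpha1.
have rho0 : 0 < rho n by apply: lt_le_trans rho2.
have le_g : (C' + 4) * ln (n%:R : R) * (rho n / alpha n) <= (g n)%:R by near: n.
have ln_n : 0 < ln (n%:R : R) by rewrite ln_gt0 // ltr1n.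
have g0 : (0 < g n)%N.
  rewrite -(ltr_nat R); apply: lt_le_trans le_g.
  by rewrite mulr_gt0 ?divr_gt0 // mulr_gt0 //; lra.
apply: le_trans (Pr_good_samples (b := C') rho0 lddD _ (erefl _) _ n2 imax_n (g_n alpha1)) _ => //.
  by rewrite -ler_pdivrMr ?divr_gt0 // invf_div.
apply: le_Pr => w /= [rad sep].
apply: (good_samples_oblivious _ g0 alpha1 rho2 _ wG (prodRt w) rad sep le_A).
- exact: ltnW.
- by near: n.
- exact: expR_gt0.
Unshelve. all: by end_near. Qed.
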